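(* Let $W=(\mathbf{z}_p)_{p\ge 0}$ be the infinite $S$-walk, with $S=\{\mathbf{i},\mathbf{j},\mathbf{k}\}\subset\mathbb{Z}^3$, produced by the Gerver–Ramsey construction described in the context. Then $W$ has no $189$ collinear points; that is, no straight line in $\mathbb{R}^3$ contains $189$ (or more) of the points of $W$.
   Context: Let $\mathbf{i},\mathbf{j},\mathbf{k}$ be the three standard orthonormal unit vectors of $\mathbb{R}^3$. For $S\subset\mathbb{Z}^3$, an $S$-walk is a (finite or infinite) sequence of vectors $(\mathbf{z}_p)$ with $\mathbf{z}_{p+1}-\mathbf{z}_p\in S$ for all $p$. Gerver–Ramsey construction. Define operators $\alpha,\beta$ on $\{\mathbf{i},\mathbf{j},\mathbf{k}\}$ by $\alpha\mathbf{i}=\mathbf{j}$, $\alpha\mathbf{j}=\mathbf{i}$, $\alpha\mathbf{k}=\mathbf{k}$ and $\beta\mathbf{i}=\mathbf{i}$, $\beta\mathbf{j}=\mathbf{k}$, $\beta\mathbf{k}=\mathbf{j}$. For finite sequences $A=(a_1,\dots,a_n)$ and $B=(b_1,\dots,b_m)$ of these vectors, write $RA=(a_n,\dots,a_1)$, $(A,B)=(a_1,\dots,a_n,b_1,\dots,b_m)$ (concatenation), and, for an operator $\theta$, $\theta A=(\theta a_1,\dots,\theta a_n)$. Let $A_0=(\mathbf{i})$ and $$A_{n+1}=(A_n,\ \alpha A_n,\ R\beta A_n,\ A_n,\ R\beta\alpha A_n,\ R\beta A_n,\ A_n)\qquad(n\ge 0).$$ Each $A_n$ has length $7^n$ and is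 a prefix of $A_{n+1}$, so there is a unique infinite sequence $(\mathbf{v}_p)_{p\ge1}$ with $(\mathbf{v}_1,\dots,\mathbf{v}_{7^n})=A_n$ for all $n$. Put $\mathbf{z}_0=\mathbf{0}$ and $\mathbf{z}_p=\sum_{q=1}^p\mathbf{v}_q$ for $p\ge 1$, and $W=(\mathbf{z}_p)_{p\ge0}$. *)

(* Defs.v *)
From HB Require Import structures.
From mathcomp Require Import all_boot all_order all_algebra.
From mathcomp Require Import boolp classical_sets reals.
Set Implicit Arguments.
Unset Strict Implicit.
Unset Printing Implicit Defensive.
Import Order.TTheory GRing.Theory Num.Theory.

Local Open Scope ring_scope.
Local Open Scope classical_set_scope.

(* The set {i, j, k}, kept as a type of symbols so that the words [word n]
   compute; [vec] sends each symbol to the vector it stands for. *)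
Inductive dir := Di | Dj | Dk.

Definition vec (d : dir) : 'rV[int]_3 :=
  match d with
  | Di => delta_mx 0 0
  | Dj => delta_mx 0 1
  | Dk => delta_mx 0 2
  end.

Definition steps : set 'rV[int]_3 := range vec.

Definition is_walk (S : set 'rV[int]_3) (z : nat -> 'rV[int]_3) : Prop :=
  forall p, S (z p.+1 - z p).

Definition alpha (d : dir) : dir :=
  match d with Di => Dj | Dj => Di | Dk => Dk end.

Definition beta (d : dir) : dir :=
  match d with Di => Di | Dj => Dk | Dk => Dj end.

(* A_n of the Gerver-Ramsey construction *)
Fixpoint word (n : nat) : seq dir :=
  if n is m.+1 then
    let A := word m in
    A ++ map alpha A ++ rev (map beta A) ++ A
      ++ rev (map (beta \o alpha) A) ++ rev (map beta A) ++ A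
  else [:: Di].

(* The infinite sequence (v_p), p >= 1, having every A_n as a prefix. As
   p <= 7 ^ p, the word A_p is long enough to contain v_p; the value at p = 0
   is junk. See [GR_stepP] and [GR_step_unique]. *)
Definition GR_step (p : nat) : dir := nth Di (word p) p.-1.

Definition GR_walk (p : nat) : 'rV[int]_3 :=
  \sum_(1 <= q < p.+1) vec (GR_step q).

Definition GR_points (R : realType) : set 'rV[R]_3 :=
  range (fun p : nat => map_mx intr (GR_walk p)).

Definition is_line (R : realType) (L : set 'rV[R]_3) : Prop :=
  exists a u : 'rV[R]_3, u != 0 /\ L = range (fun t : R => a + t *: u).

Lemma size_word n : size (word n) = (7 ^ n)%N.
Proof.
elim: n => //= n IHn.
by rewrite !size_cat !size_rev !size_map IHn expnS !mulSn mul0n addn0.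
Qed.

Lemma nth_word m n q : (m <= n)%N -> (q < 7 ^ m)%N ->
  nth Di (word n) q = nth Di (word m) q.
Proof.
move=> le_mn lt_q; rewrite -(subnKC le_mn); elim: (n - m)%N => [|k IHk].
  by rewrite addn0.
rewrite addnS /= nth_cat size_word IHk.
by rewrite (leq_trans lt_q) // leq_exp2l // leq_addr.
Qed.

Lemma GR_stepP n : [seq GR_step q | q <- iota 1 (7 ^ n)] = word n.
Proof.
apply: (@eq_from_nth _ Di); rewrite size_map size_iota ?size_word // => q lt_q.
rewrite (nth_map 0%N) ?size_iota // nth_iota // add1n /GR_step -pred_Sn.
have lt_qq : (q < 7 ^ q.+1)%N by apply: ltnW; apply: ltn_expl.
by case: (leqP n q.+1) => [|/ltnW] le; [|symmetry]; apply: nth_word.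
Qed.

Lemma GR_step_unique (v : nat -> dir) :
  (forall n, [seq v q | q <- iota 1 (7 ^ n)] = word n) ->
  forall p, (0 < p)%N -> v p = GR_step p.
Proof.
move=> vP [//|p] _; have lt_p : (p < 7 ^ p.+1)%N.
  by apply: ltnW; apply: ltn_expl.
rewrite /GR_step -pred_Sn -vP (nth_map 0%N) ?size_iota //.
by rewrite nth_iota // add1n.
Qed.

Lemma GR_walk_is_walk : is_walk steps GR_walk.
Proof.
move=> p; exists (GR_step p.+1) => //.
by rewrite /GR_walk [in RHS]big_nat_recr //= addrAC subrr add0r.
Qed.

(* Main.v *)
Require Import Defs.
From Stdlib Require Import ZArith Lia.
From mathcomp Require Import all_boot all_order all_algebra.
From mathcomp Require Import boolp classical_sets reals.
From mathcomp Require Import ssrZ zify ring.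
Set Implicit Arguments.
Unset Strict Implicit.
Unset Printing Implicit Defensive.

Local Open Scope Z_scope.
Local Arguments Z.add : simpl never.
Local Arguments Z.sub : simpl never.
Local Arguments Z.mul : simpl never.
Local Arguments Z.pow : simpl never.
Local Arguments Z.of_nat : simpl never.

(* The walk is self-similar in base 7: its blocks of [7 ^ n] steps are copies of
   [word n], relabelled and possibly reversed, and the projection of such a
   block along (1,1,1) is [4 ^ n] times the projection of one step. Hence the
   projected displacement of a window of [n] steps is bounded above and below by
   constants times [n ^ g], where [g = log 4 / log 7 < 1]. The lower bound says
   that the projected walk never comes back close to itself. To prove both
   bounds, view a window as joining a point of a block to a point of a
   later block of the same level: if the two blocks, seen as boxes, do not
   already force the bounds, split each block in 7. By self-similarity there are
   finitely many starting pairs, and this search stops on each of them.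
   On a line the displacement is proportional to the number of steps. If [h] is
   the smallest and [n] the largest gap between 189 collinear points, then
   [n >= 188 * h], so the two constants must differ by a factor at least
   [188 ^ (1 - g) > 4.5], whereas the bounds hold with constants of ratio 4.375. *)

(** * Blocks *)

(** Triples over [Z] rather than row vectors over [int], so that the finite checks compute. *)
Record vect := Vect { ci : Z; cj : Z; ck : Z }.

Definition vzero := Vect 0 0 0.
Definition vmap2 (f : Z -> Z -> Z) (v w : vect) :=
  Vect (f (ci v) (ci w)) (f (cj v) (cj w)) (f (ck v) (ck w)).
Definition vadd := vmap2 Z.add.
Definition vsub := vmap2 Z.sub.
Definition vscale (c : Z) (v : vect) := Vect (c * ci v) (c * cj v) (c * ck v).
Definition vle (v w : vect) := ci v <= ci w /\ cj v <= cj w /\ ck v <= ck w.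

Lemma vaddA u v w : vadd u (vadd v w) = vadd (vadd u v) w.
Proof. by congr Vect; rewrite /=; ring. Qed.

Lemma vaddC v w : vadd v w = vadd w v.
Proof. by congr Vect; rewrite /=; ring. Qed.

Lemma vadd0 v : vadd vzero v = v.
Proof. by case: v. Qed.

Lemma vscale0 c : vscale c vzero = vzero.
Proof. by congr Vect; rewrite /=; ring. Qed.

Lemma vscaleA c e v : vscale c (vscale e v) = vscale (c * e) v.
Proof. by congr Vect; rewrite /=; ring. Qed.

Lemma vscaleD c v w : vscale c (vadd v w) = vadd (vscale c v) (vscale c w).
Proof. by congr Vect; rewrite /=; ring. Qed.

Definition same (d e : dir) : bool :=
  match d, e with Di, Di | Dj, Dj | Dk, Dk => true | _, _ => false end.

Definition step (e d : dir) : Z := if same e d then 2 else -1.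
Definition vstep (e : dir) := Vect (step e Di) (step e Dj) (step e Dk).

(* Coordinate [d] is 3 * (number of [d] in [w]) - size w, three times the
   coordinate of the projection along (1,1,1). *)
Definition disp (w : seq dir) : vect := foldr (fun e => vadd (vstep e)) vzero w.

Lemma disp_cat u v : disp (u ++ v) = vadd (disp u) (disp v).
Proof.
by elim: u => [|e u /= ->]; rewrite ?vadd0 ?vaddA. Qed.

Definition rot (o : bool) (d : dir) : dir :=
  match d with
  | Di => if o then Dj else Dk
  | Dj => if o then Dk else Di
  | Dk => if o then Di else Dj
  end.

(* The permutation of {i, j, k} applied to a block is given by the image
   [letter] of i and by whether it preserves the cyclic order ([direct]). *)
Record state := State { letter : dir; direct : bool; reversed : bool }.

Definition state0 := State Di true false.

Definition relabel (s : state) (d : dir) : dir :=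
  match d with
  | Di => letter s
  | Dj => rot (direct s) (letter s)
  | Dk => rot (~~ direct s) (letter s)
  end.

(** The seven factors in the recursion of [word]: composing with [alpha] or [beta] flips [direct],
    with both keeps it; reversal flips [reversed], and a reversed block lists its factors
    backwards. *)
Definition children (s : state) : seq state :=
  let: State a o r := s in
  let l := [:: State a o r; State (rot o a) (~~ o) r; State a (~~ o) (~~ r);
               State a o r; State (rot (~~ o) a) o (~~ r);
               State a (~~ o) (~~ r); State a o r] in
  if r then rev l else l.

Fixpoint block (n : nat) (s : state) : seq dir :=
  if n is m.+1 then flatten [seq block m t | t <- children s]
  else [:: letter s].

Lemma blockE n s : block n s =
  let w := map (relabel s) (word n) in if reversed s then rev w else w.
Proof.
have Ea a o r : relabel (State (rot o a) (~~ o) r) =1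
    relabel (State a o r) \o alpha by move: a o => [] [] [].
have Eb a o r r' : relabel (State a (~~ o) r) =1
    relabel (State a o r') \o beta by move: a o => [] [] [].
have Eba a o r r' : relabel (State (rot (~~ o) a) o r) =1
    relabel (State a o r') \o (beta \o alpha) by move: a o => [] [] [].
elim: n s => [|n IHn] [a o r] /=; first by case: r.
case: r; rewrite /= !IHn /= !(eq_map (Ea a o _));
  [rewrite !(eq_map (Eb a o _ true)) !(eq_map (Eba a o _ true)) |
   rewrite !(eq_map (Eb a o _ false)) !(eq_map (Eba a o _ false))].
all: by rewrite ?cats0 !map_cat !map_rev -!map_comp ?rev_cat ?revK -?catA.
Qed.

Lemma word_block n : word n = block n state0.
Proof. by rewrite blockE /= -[LHS]map_id; apply: eq_map; case. Qed.

Lemma size_children s : size (children s) = 7%N.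
Proof. by case: s => a o []. Qed.

Lemma size_block n s : size (block n s) = (7 ^ n)%N.
Proof. by rewrite blockE /=; case: ifP; rewrite ?size_rev size_map size_word. Qed.

(** Five of the seven letters are [letter s] and the other two directions occur once each:
    [3 * 5 - 7 = 4 * 2] and [3 * 1 - 7 = - 4]. *)
Lemma disp_children s :
  disp (map letter (children s)) = vscale 4 (vstep (letter s)).
Proof. by case: s => [[] [] []]. Qed.

Lemma disp_block n s :
  disp (block n s) = vscale (4 ^ Z.of_nat n) (vstep (letter s)).
Proof.
elim: n s => [|n IHn] s.
  by congr Vect; rewrite /= Z.add_0_r; case: (step _ _).
have E l : disp (flatten [seq block n t | t <- l]) =
    vscale (4 ^ Z.of_nat n) (disp (map letter l)).
  by elim: l => [|t l /= IHl] /=; rewrite ?vscale0 // disp_cat IHl IHn vscaleD.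
rewrite [block _ _]/= E disp_children vscaleA Nat2Z.inj_succ Z.pow_succ_r 1?Z.mul_comm //.
exact: Nat2Z.is_nonneg.
Qed.

Lemma disp_blocks n l :
  disp (flatten [seq block n t | t <- l]) =
  vscale (4 ^ Z.of_nat n) (disp (map letter l)).
Proof.
elim: l => [|t l IHl] /=; rewrite ?vscale0 //.
by rewrite disp_cat IHl disp_block vscaleD.
Qed.

Definition child (s : state) (i : nat) := nth state0 (children s) i.
Definition offset (s : state) (i : nat) := disp (map letter (take i (children s))).

Lemma take_blocks n l i p : (i < size l)%N -> (p <= 7 ^ n)%N ->
  take (i * 7 ^ n + p)%N (flatten [seq block n t | t <- l]) =
  flatten [seq block n t | t <- take i l] ++ take p (block n (nth state0 l i)).
Proof.
move=> lt_i le_p; elim: l i lt_i => // s l IHl [_|i /IHl IHi] /=.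
  rewrite mul0n add0n take_cat size_block; case: ltnP => // ge_p.
  have -> : p = (7 ^ n)%N by apply/eqP; rewrite eqn_leq le_p.
  by rewrite subnn take0 take_oversize ?cats0 ?size_block.
rewrite take_cat size_block mulSn -addnA ltnNge leq_addr /=.
by rewrite addKn IHi catA.
Qed.

Definition pos (n : nat) (s : state) (p : nat) := disp (take p (block n s)).

Lemma posS n s i p : (i < 7)%N -> (p <= 7 ^ n)%N ->
  pos n.+1 s (i * 7 ^ n + p) =
  vadd (vscale (4 ^ Z.of_nat n) (offset s i)) (pos n (child s i) p).
Proof.
move=> lt_i le_p; rewrite /pos take_blocks ?size_children //.
by rewrite disp_cat disp_blocks.
Qed.

(* In units of [4 ^ n], four times the displacements from the start of a block
   of state [s] and level [n] lie between [lower s] and [upper s]. *)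
Definition lower_coord (s : state) (d : dir) : Z :=
  if same d (letter s) then 0
  else if reversed s && same d (rot (direct s) (letter s)) then -5 else -4.
Definition upper_coord (s : state) (d : dir) : Z :=
  if same d (letter s) then 8
  else if ~~ reversed s && same d (rot (direct s) (letter s)) then 1 else 0.
Definition lower s := Vect (lower_coord s Di) (lower_coord s Dj) (lower_coord s Dk).
Definition upper s := Vect (upper_coord s Di) (upper_coord s Dj) (upper_coord s Dk).

(** This finite check makes the boxes inductive: those of the seven sub-blocks fit inside the box of
    the block. *)
Lemma hull_step s i : (i < 7)%N ->
  vle (vscale 4 (lower s)) (vadd (vscale 4 (offset s i)) (lower (child s i))) /\
  vle (vadd (vscale 4 (offset s i)) (upper (child s i))) (vscale 4 (upper s)).
Proof.
by case: i => [|[|[|[|[|[|[|//]]]]]]] _; case: s => [[] [] []]; vm_compute;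
  do ![split] => //.
Qed.

Lemma pos_hull n s p : (p < 7 ^ n)%N ->
  vle (vscale (4 ^ Z.of_nat n) (lower s)) (vscale 4 (pos n s p)) /\
  vle (vscale 4 (pos n s p)) (vscale (4 ^ Z.of_nat n) (upper s)).
Proof.
elim: n s p => [|n IHn] s p lt_p.
  have -> : p = 0%N by move: lt_p; rewrite expn0; lia.
  by case: s => [[] [] []]; vm_compute; do ![split] => //.
have q_gt0 : (0 < 7 ^ n)%N by rewrite expn_gt0.
have lt_i : (p %/ 7 ^ n < 7)%N by rewrite ltn_divLR // -expnS.
have lt_r : (p %% 7 ^ n < 7 ^ n)%N by rewrite ltn_mod.
rewrite (divn_eq p (7 ^ n)%N) posS //; last exact: ltnW.
have [] := hull_step s lt_i; have [] := IHn (child s (p %/ 7 ^ n)%N) _ lt_r.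
rewrite Nat2Z.inj_succ Z.pow_succ_r; last lia.
have : 0 < 4 ^ Z.of_nat n by lia.
move: (4 ^ Z.of_nat n) (offset _ _) (pos _ _ _) (lower _) (upper _) (lower _) (upper _).
rewrite /vle /= => q o x l' u' l u q0 [A1 [A2 A3]] [B1 [B2 B3]] [C1 [C2 C3]] [D1 [D2 D3]].
have M y z : y <= z -> q * y <= q * z by apply: Z.mul_le_mono_nonneg_l; lia.
move: (M _ _ C1) (M _ _ C2) (M _ _ C3) (M _ _ D1) (M _ _ D2) (M _ _ D3).
by lia.
Qed.

(** * The growth function *)

Definition max3 v := Z.max (ci v) (Z.max (cj v) (ck v)).
Definition min3 v := Z.min (ci v) (Z.min (cj v) (ck v)).
(* Only [gauge x x] is a size; the two arguments allow [x] to be replaced by the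
   two ends of a box containing it. The weights 5 and 7 make the ratio between
   the two bounds nearly optimal. *)
Definition gauge (v w : vect) := Z.max (5 * max3 v) (-7 * min3 w).

Lemma gauge_le v v' w w' : vle v v' -> vle w' w -> gauge v w <= gauge v' w'.
Proof. by rewrite /vle /gauge /max3 /min3; lia. Qed.

Lemma gauge_scale c v w : 0 <= c ->
  gauge (vscale c v) (vscale c w) = c * gauge v w.
Proof.
move=> c_ge0; rewrite /gauge /max3 /min3 /=.
rewrite !Z.mul_max_distr_nonneg_l // !Z.mul_min_distr_nonneg_l //.
move: (Z.max _ _) (Z.min _ _) => x y.
rewrite -(@Z.mul_max_distr_nonneg_l (5 * x)) //; f_equal; ring.
Qed.

(** The two linear forms meet at [3 * n = 8 * u]; their minimum is increasing and concave in [n]. *)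
Definition chord (n u : Z) := Z.min (13 * (3 * n + 2 * u)) (10 * (3 * n + 5 * u)).

(* For [7 ^ k <= n < 7 ^ k.+1], [F k n / 7 ^ k] interpolates [65 * n ^ g], [g = log 4 / log 7],
   with nodes [7 ^ k], [8/3 * 7 ^ k] (as [(8/3) ^ g] is nearly 2) and [7 ^ k.+1]. *)
Definition F (k : nat) (n : Z) := 4 ^ Z.of_nat k * chord n (7 ^ Z.of_nat k).

Definition F_le_at (k : nat) (c n v : Z) : bool :=
  let u := 7 ^ Z.of_nat k in
  [&& u <=? n, n <? 7 * u & c * F k n <=? v * u].
Definition F_ge_at (k : nat) (c n v : Z) : bool :=
  let u := 7 ^ Z.of_nat k in
  [&& u <=? n, n <? 7 * u & v * u <=? c * F k n].
Definition F_le c n v := exists k, F_le_at k c n v.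
Definition F_ge c n v := exists k, F_ge_at k c n v.

Lemma F_le_atP k c n v :
  reflect (7 ^ Z.of_nat k <= n < 7 * 7 ^ Z.of_nat k /\
    c * F k n <= v * 7 ^ Z.of_nat k)
  (F_le_at k c n v).
Proof.
apply: (iffP and3P) => [[/Z.leb_le ? /Z.ltb_lt ? /Z.leb_le ?]|[[? ?] ?]] //.
by split; [apply/Z.leb_le|apply/Z.ltb_lt|apply/Z.leb_le].
Qed.

Lemma F_ge_atP k c n v :
  reflect (7 ^ Z.of_nat k <= n < 7 * 7 ^ Z.of_nat k /\
    v * 7 ^ Z.of_nat k <= c * F k n)
  (F_ge_at k c n v).
Proof.
apply: (iffP and3P) => [[/Z.leb_le ? /Z.ltb_lt ? /Z.leb_le ?]|[[? ?] ?]] //.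
by split; [apply/Z.leb_le|apply/Z.ltb_lt|apply/Z.leb_le].
Qed.

Lemma pow_gt0 a k : 0 <? a -> 0 < a ^ Z.of_nat k.
Proof. by move=> /Z.ltb_lt a_gt0; apply: Z.pow_pos_nonneg; lia. Qed.

Lemma powD a j k : a ^ Z.of_nat (j + k) = a ^ Z.of_nat j * a ^ Z.of_nat k.
Proof. by rewrite Nat2Z.inj_add Z.pow_add_r //; apply: Nat2Z.is_nonneg. Qed.

Lemma powS a k : a ^ Z.of_nat k.+1 = a * a ^ Z.of_nat k.
Proof. by rewrite -addn1 addnC powD Z.pow_1_r. Qed.

Lemma chord_scale c n u : 0 <= c -> chord (c * n) (c * u) = c * chord n u.
Proof.
move=> c_ge0; rewrite /chord -Z.mul_min_distr_nonneg_l //; f_equal; ring.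
Qed.

Lemma level n : 0 < n ->
  exists k, 7 ^ Z.of_nat k <= n < 7 * 7 ^ Z.of_nat k.
Proof.
move=> n_gt0; have [m] : exists m, n < 7 ^ Z.of_nat m.
  by exists (Z.to_nat n); rewrite Z2Nat.id; [apply: Z.pow_gt_lin_r|]; lia.
elim: m => [|m IHm]; first by rewrite Z.pow_0_r; lia.
rewrite powS => lt_n; case: (Z_lt_le_dec n (7 ^ Z.of_nat m)) => [/IHm //|le_n].
by exists m.
Qed.

Lemma pow_ge1 a k : 0 <? a -> 1 <= a ^ Z.of_nat k.
Proof. by move/(pow_gt0 k); lia. Qed.

Lemma level_le k l n m : n <= m -> 7 ^ Z.of_nat k <= n ->
  m < 7 * 7 ^ Z.of_nat l -> (k <= l)%N.
Proof.
move=> le_nm le_n lt_m; rewrite leqNgt; apply/negP => lt_lk.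
have := @pow_ge1 7 (k - l.+1) isT; have := @pow_gt0 7 l.+1 isT.
move: le_n; rewrite -(subnK lt_lk) powD powS; nia.
Qed.

(** On one scale [chord] increases; distinct scales are separated by [260 * 4 ^ k = 65 * 4 ^ k.+1],
    the value at [7 ^ k.+1]. *)
Lemma F_mono k l n m : 0 < n <= m ->
  7 ^ Z.of_nat k <= n < 7 * 7 ^ Z.of_nat k ->
  7 ^ Z.of_nat l <= m < 7 * 7 ^ Z.of_nat l ->
  F k n * 7 ^ Z.of_nat l <= F l m * 7 ^ Z.of_nat k.
Proof.
rewrite /F; move=> [n_gt0 le_nm] [k1 k2] [l1 l2].
have := level_le le_nm k1 l2.
rewrite leq_eqVlt => /orP[/eqP Ekl|/subnK Ekl].
  rewrite -Ekl -!Z.mul_assoc; apply: Z.mul_le_mono_nonneg_l.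
    by have := @pow_gt0 4 k isT; lia.
  apply: Z.mul_le_mono_nonneg_r; first by have := @pow_gt0 7 k isT; lia.
  by rewrite /chord; lia.
move: l1 l2; rewrite -Ekl !powD !powS; move: (l - k.+1)%N => j.
have := @pow_ge1 4 j isT; have := @pow_gt0 7 j isT.
have := @pow_gt0 4 k isT; have := @pow_gt0 7 k isT.
move: (7 ^ Z.of_nat k) (4 ^ Z.of_nat k) (7 ^ Z.of_nat j) (4 ^ Z.of_nat j) k1 k2.
move=> u w r t k1 k2 u0 w0 r0 t1 l1 l2.
have A : chord n u <= 260 * u by rewrite /chord; lia.
have B : 65 * (r * (7 * u)) <= chord m (r * (7 * u)).
  by move: (r * (7 * u)) l1 => z; rewrite /chord; lia.
apply: (@Z.le_trans _ (w * (260 * u) * (r * (7 * u)))).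
  by apply: Z.mul_le_mono_nonneg_r; [nia|apply: Z.mul_le_mono_nonneg_l; lia].
apply: (@Z.le_trans _ (t * (4 * w) * (65 * (r * (7 * u))) * u)); last first.
  by apply: Z.mul_le_mono_nonneg_r; [lia|apply: Z.mul_le_mono_nonneg_l; nia].
have E : 0 <= 1820 * w * r * u * u by do ![apply: Z.mul_nonneg_nonneg => //; try lia].
have := Z.mul_le_mono_nonneg_l _ _ _ E t1; lia.
Qed.

Lemma F_le_mono c n m v : 0 <= c -> 0 < n <= m -> F_le c m v -> F_le c n v.
Proof.
move=> c_ge0 le_nm [l /F_le_atP [Hl le_v]].
have [|k Hk] := @level n; first lia.
exists k; apply/F_le_atP; split=> //.
have := F_mono le_nm Hk Hl.
have := @pow_gt0 7 k isT; have := @pow_gt0 7 l isT; move: le_v.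
move: (F k n) (F l m) (7 ^ Z.of_nat k) (7 ^ Z.of_nat l) => x y a b.
move=> le_v b_gt0 a_gt0 le_xy; apply: (@Zmult_le_reg_r _ _ b); first lia.
have := Z.mul_le_mono_nonneg_l _ _ _ c_ge0 le_xy.
have : c * y * a <= v * b * a by apply: Z.mul_le_mono_nonneg_r; lia.
lia.
Qed.

Lemma F_ge_mono c n m v : 0 <= c -> 0 < n <= m -> F_ge c n v -> F_ge c m v.
Proof.
move=> c_ge0 le_nm [k /F_ge_atP [Hk le_v]].
have [|l Hl] := @level m; first lia.
exists l; apply/F_ge_atP; split=> //.
have := F_mono le_nm Hk Hl.
have := @pow_gt0 7 k isT; have := @pow_gt0 7 l isT; move: le_v.
move: (F k n) (F l m) (7 ^ Z.of_nat k) (7 ^ Z.of_nat l) => x y a b.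
move=> le_v b_gt0 a_gt0 le_xy; apply: (@Zmult_le_reg_r _ _ a); first lia.
have := Z.mul_le_mono_nonneg_l _ _ _ c_ge0 le_xy.
have : v * a * b <= c * x * b by apply: Z.mul_le_mono_nonneg_r; lia.
lia.
Qed.

(** Multiplying [n] by 7 shifts the scale and multiplies [F k n / 7 ^ k] by exactly 4, so one test
    on [m] serves blocks of every level. *)
Lemma F_le_scale c j n v : F_le c n v ->
  F_le c (7 ^ Z.of_nat j * n) (4 ^ Z.of_nat j * v).
Proof.
move=> [k /F_le_atP [Hk le_v]]; exists (j + k)%N; apply/F_le_atP.
rewrite /F !powD; have := @pow_gt0 4 j isT; have := @pow_gt0 7 j isT.
move: (7 ^ Z.of_nat j) (4 ^ Z.of_nat j) => a b a_gt0 b_gt0.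
rewrite chord_scale; last lia.
split; first by split; [apply: Z.mul_le_mono_nonneg_l|nia]; lia.
have : a * b * (c * F k n) <=
       a * b * (v * 7 ^ Z.of_nat k) by apply: Z.mul_le_mono_nonneg_l; nia.
by rewrite /F; lia.
Qed.

Lemma F_ge_scale c j n v : F_ge c n v ->
  F_ge c (7 ^ Z.of_nat j * n) (4 ^ Z.of_nat j * v).
Proof.
move=> [k /F_ge_atP [Hk le_v]]; exists (j + k)%N; apply/F_ge_atP.
rewrite /F !powD; have := @pow_gt0 4 j isT; have := @pow_gt0 7 j isT.
move: (7 ^ Z.of_nat j) (4 ^ Z.of_nat j) => a b a_gt0 b_gt0.
rewrite chord_scale; last lia.
split; first by split; [apply: Z.mul_le_mono_nonneg_l|nia]; lia.
have : a * b * (v * 7 ^ Z.of_nat k) <=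
       a * b * (c * F k n)
  by apply: Z.mul_le_mono_nonneg_l; nia.
by rewrite /F; lia.
Qed.

(** The constants [3 / 64] and [105 / 512] have ratio [35 / 8 = 4.375]. *)
Definition good (n : Z) (x : vect) : Prop :=
  F_le 3 n (64 * gauge x x) /\ F_ge 105 n (512 * gauge x x).

(** The linear forms of [chord] have positive constant terms, and [4 ^ j <= 7 ^ j] across scales;
    hence growth is at most linear from [n] to [m]. *)
Lemma F_slope k l n m : 0 < n <= m ->
  7 ^ Z.of_nat k <= n < 7 * 7 ^ Z.of_nat k ->
  7 ^ Z.of_nat l <= m < 7 * 7 ^ Z.of_nat l ->
  F l m * n * 7 ^ Z.of_nat k <= F k n * m * 7 ^ Z.of_nat l.
Proof.
rewrite /F; move=> [n_gt0 le_nm] [k1 k2] [l1 l2].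
have := level_le le_nm k1 l2.
rewrite leq_eqVlt => /orP[/eqP Ekl|/subnK Ekl].
  rewrite -Ekl; apply: Z.mul_le_mono_nonneg_r.
    by have := @pow_gt0 7 k isT; lia.
  rewrite -!Z.mul_assoc; apply: Z.mul_le_mono_nonneg_l.
    by have := @pow_gt0 4 k isT; lia.
  have := @pow_gt0 7 k isT; move: (7 ^ _) => u u_gt0.
  have E : n * u <= m * u by apply: Z.mul_le_mono_nonneg_r; lia.
  rewrite /chord ![_ * n]Z.mul_comm ![_ * m]Z.mul_comm.
  rewrite -!Z.mul_min_distr_nonneg_l; [|lia..].
  by lia.
move: l1 l2; rewrite -Ekl !powD !powS; move: (l - k.+1)%N => j.
have : 4 ^ Z.of_nat j <= 7 ^ Z.of_nat j by apply: Z.pow_le_mono_l; lia.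
have := @pow_gt0 4 j isT; have := @pow_gt0 7 j isT.
have := @pow_gt0 4 k isT; have := @pow_gt0 7 k isT.
move: (7 ^ Z.of_nat k) (4 ^ Z.of_nat k) (7 ^ Z.of_nat j) (4 ^ Z.of_nat j) k1 k2.
move=> u w r t k1 k2 u0 w0 r0 t0 le_tr l1 l2.
have A : 260 * n <= 7 * chord n u by rewrite /chord; lia.
have B : chord m (r * (7 * u)) <= 65 * m.
  by move: (r * (7 * u)) l1 => z; rewrite /chord; lia.
apply: (@Z.le_trans _ (t * (4 * w) * (65 * m) * n * u)).
  do 2![apply: Z.mul_le_mono_nonneg_r; first by lia].
  by apply: Z.mul_le_mono_nonneg_l; nia.
apply: (@Z.le_trans _ (r * (w * (260 * n) * m * u))).
  have E : 0 <= w * (260 * n) * m * u by do ![apply: Z.mul_nonneg_nonneg => //; try lia].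
  have := Z.mul_le_mono_nonneg_r _ _ _ E le_tr; lia.
have E : 0 <= r * w * m * u by do ![apply: Z.mul_nonneg_nonneg => //; try lia].
have := Z.mul_le_mono_nonneg_l _ _ _ E A; lia.
Qed.

Lemma good_far h n x y : 0 < h -> 188 * h <= n ->
  vscale n x = vscale h y -> good h x -> good n y -> False.
Proof.
move=> h_gt0 le_hn Exy [[k /F_le_atP [Hk lo_x]] _] [_ [l /F_ge_atP [Hl up_y]]].
have Eg : n * gauge x x = h * gauge y y by rewrite -!gauge_scale ?Exy; lia.
have [|j Hj] := @level (188 * h); first lia.
have slope := F_slope (conj (Z.mul_pos_pos 188 h ltac:(lia) h_gt0) le_hn) Hj Hl.
have far : 512 * 188 * gauge x x * 7 ^ Z.of_nat j <= 105 * F j (188 * h).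
  have := @pow_gt0 7 j isT; have := @pow_gt0 7 l isT; move: slope up_y Eg.
  move: (F j _) (F l _) (7 ^ Z.of_nat j) (7 ^ Z.of_nat l) => A B u w.
  move: (gauge x x) (gauge y y) => P Q slope up_y Eg w_gt0 u_gt0.
  apply: (@Zmult_le_reg_r _ _ (n * w)); first by apply: Z.lt_gt; nia.
  have -> : 512 * 188 * P * u * (n * w) = 512 * 188 * u * w * (n * P) by ring.
  rewrite Eg.
  have E : 0 <= 188 * h * u by nia.
  have := Z.mul_le_mono_nonneg_r _ _ _ E up_y; lia.
have /subnK Ej : (k <= j)%N by apply: (@level_le k j h (188 * h)); lia.
move: Hj far lo_x; rewrite -Ej; move: (j - k)%N => e; rewrite /F !powD.
have := @pow_gt0 7 k isT; have := @pow_gt0 4 k isT; move: Hk.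
move: (7 ^ Z.of_nat k) (4 ^ Z.of_nat k) (gauge x x) => u w P Hk w_gt0 u_gt0.
(* As [u <= h < 7 * u] and [49 <= 188 < 343], the scale of [188 * h] is two or three above that of
   [h]. In both cases the gauge cancels, leaving a piecewise linear inequality to refute. *)
case: e => [|[|[|[|e]]]] He.
- by move: He; rewrite !Z.pow_0_r; lia.
- by move: He; rewrite !powS !Z.pow_0_r; lia.
- rewrite !powS !Z.pow_0_r => far lo_x.
  have : 8 * 188 * 3 * 49 * chord h u <= 105 * 16 * chord (188 * h) (49 * u).
    apply: (@Zmult_le_reg_r _ _ (w * u)); first by apply: Z.lt_gt; nia.
    have -> : 49 * u = 7 * (7 * 1) * u by ring.
    have := Z.mul_le_mono_nonneg_r _ _ u (Z.lt_le_incl _ _ u_gt0) far.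
    have := Z.mul_le_mono_nonneg_r _ _ u (Z.lt_le_incl _ _ u_gt0) lo_x.
    by lia.
  by rewrite /chord; lia.
- rewrite !powS !Z.pow_0_r => far lo_x.
  have : 8 * 188 * 3 * 343 * chord h u <= 105 * 64 * chord (188 * h) (343 * u).
    apply: (@Zmult_le_reg_r _ _ (w * u)); first by apply: Z.lt_gt; nia.
    have -> : 343 * u = 7 * (7 * (7 * 1)) * u by ring.
    have := Z.mul_le_mono_nonneg_r _ _ u (Z.lt_le_incl _ _ u_gt0) far.
    have := Z.mul_le_mono_nonneg_r _ _ u (Z.lt_le_incl _ _ u_gt0) lo_x.
    by lia.
  by rewrite /chord; lia.
- move: He; rewrite !powS; have := @pow_ge1 7 e isT; nia.
Qed.

(** * The search *)

(* From 2401 on this is not the scale of [n], and the range tests in [F_le_at]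
   and [F_ge_at] fail. *)
Definition scale_of (n : Z) : nat :=
  if n <? 7 then 0%N else if n <? 49 then 1%N else if n <? 343 then 2%N else 3%N.

Definition digits (s : state) : seq (Z * vect * state) :=
  [seq (Z.of_nat i, offset s i, child s i) | i <- iota 0 7].

(* [m] and [x] are the differences of index and of (projected) position between
   two blocks of the same level, of states [a] and [b]; [T] is tested on all
   pairs of their sub-blocks. *)
Definition subtrees (T : Z -> vect -> state -> state -> bool)
    (m : Z) (x : vect) (a b : state) : bool :=
  let ds := digits b in
  all (fun d : Z * vect * state =>
         let: (i, u, a') := d in
         all (fun e : Z * vect * state =>
                let: (j, v, b') := e in
                T (7 * m + j - i) (vsub (vadd (vscale 4 x) v) u) a' b') ds)
      (digits a).

(** At level 0 a window joins two initial points and cannot be split, so [m] and [x] themselves are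
    tested. *)
Definition leaf (m : Z) (x : vect) : bool :=
  F_le_at (scale_of m) 3 m (64 * gauge x x) &&
  F_ge_at (scale_of m) 105 m (512 * gauge x x).

(* The constants 3 and 105 of [good] are multiplied by 4 because [lo] and [hi]
   bound four times the displacement. *)
Definition pruned (m : Z) (x : vect) (a b : state) : bool :=
  let lo := vsub (vadd (vscale 4 x) (lower b)) (upper a) in
  let hi := vsub (vadd (vscale 4 x) (upper b)) (lower a) in
  F_le_at (scale_of (m + 1)) 12 (m + 1) (64 * gauge lo hi) &&
  F_ge_at (scale_of (m - 1)) 420 (m - 1) (512 * gauge hi lo).

(* The conditional, unlike [||], is lazy under call by value. *)
Fixpoint tree (f : nat) (m : Z) (x : vect) (a b : state) : bool :=
  if pruned m x a b then true
  else leaf m x && (if f is f'.+1 then subtrees (tree f') m x a b else false).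

(* Pairs of equal ([m = 0]) or consecutive ([m = 1]) blocks contain pairs of the
   same kind, which are left to the induction on the level. *)
Definition root (m : Z) (x : vect) (a b : state) : bool :=
  if m <=? 1 then true else tree 5 m x a b.

Definition check (s : state) : bool :=
  subtrees root 0 vzero s s &&
  all (fun i => let a := child s i in
                subtrees root 1 (vstep (letter a)) a (child s i.+1)) (iota 0 6).

(** The whole search, over twelve states: five further splittings settle every starting pair with
    [2 <= m]. *)
Lemma check_true s : check s.
Proof. by case: s => [[] [] []]; vm_compute. Qed.

(* The length and displacement of the window from the point of index [p] in a
   block of level [n] and state [a] to the point of index [q] in the block of
   state [b] which lies [m] blocks further, at displacement [4 ^ n * x]. *)
Definition gap (n : nat) (m : Z) (p q : nat) : Z :=
  m * 7 ^ Z.of_nat n + Z.of_nat q - Z.of_nat p.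

Definition window (n : nat) (x : vect) (a b : state) (p q : nat) : vect :=
  vadd (vscale (4 ^ Z.of_nat n) x) (vsub (pos n b q) (pos n a p)).

Lemma subtreesP T m x a b i j : subtrees T m x a b -> (i < 7)%N -> (j < 7)%N ->
  T (7 * m + Z.of_nat j - Z.of_nat i)
    (vsub (vadd (vscale 4 x) (offset b j)) (offset a i)) (child a i) (child b j).
Proof.
move=> HT lt_i lt_j.
have nth_digits s k : (k < 7)%N ->
    nth (0, vzero, state0) (digits s) k = (Z.of_nat k, offset s k, child s k).
  by move=> lt_k; rewrite (nth_map 0%N) ?size_iota // nth_iota.
have {}HT := all_nthP (0, vzero, state0) HT i.
have := HT ltac:(by rewrite size_map size_iota); rewrite nth_digits //.
move=> /(all_nthP (0, vzero, state0)) /(_ j); rewrite size_map size_iota => /(_ lt_j).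
by rewrite nth_digits.
Qed.

Lemma by_digits (P : Z -> vect -> Prop) n m x a b p q :
  (p < 7 ^ n.+1)%N -> (q < 7 ^ n.+1)%N ->
  (forall i j p' q', (i < 7)%N -> (j < 7)%N -> (p' < 7 ^ n)%N -> (q' < 7 ^ n)%N ->
     p = (i * 7 ^ n + p')%N -> q = (j * 7 ^ n + q')%N ->
     P (gap n (7 * m + Z.of_nat j - Z.of_nat i) p' q')
       (window n (vsub (vadd (vscale 4 x) (offset b j)) (offset a i))
          (child a i) (child b j) p' q')) ->
  P (gap n.+1 m p q) (window n.+1 x a b p q).
Proof.
have q_gt0 : (0 < 7 ^ n)%N by rewrite expn_gt0.
have digit r : (r < 7 ^ n.+1)%N -> (r %/ 7 ^ n < 7)%N.
  by move=> lt_r; rewrite ltn_divLR // -expnS.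
have rest r : (r %% 7 ^ n < 7 ^ n)%N by rewrite ltn_mod.
move=> lt_p lt_q; move: (digit p lt_p) (digit q lt_q) (rest p) (rest q).
move: (divn_eq p (7 ^ n)%N) (divn_eq q (7 ^ n)%N).
move: (p %/ _)%N (p %% _)%N (q %/ _)%N (q %% _)%N => i p' j q' Ep Eq lt_i lt_j lt_p' lt_q'.
move=> /(_ i j p' q' lt_i lt_j lt_p' lt_q' Ep Eq).
have -> : gap n.+1 m p q = gap n (7 * m + Z.of_nat j - Z.of_nat i) p' q'.
  have Z7 : Z.of_nat (7 ^ n)%N = 7 ^ Z.of_nat n by lia.
  rewrite /gap powS Ep Eq !Nat2Z.inj_add !Nat2Z.inj_mul Z7; ring.
congr P; rewrite /window Ep Eq !posS; [|by auto using ltnW..]; rewrite powS.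
by congr Vect; rewrite /=; ring.
Qed.

(** The length lies between [7 ^ n * (m - 1)] and [7 ^ n * (m + 1)], and the displacement in the box
    from [lo] to [hi]; by monotonicity the worst ends suffice. *)
Lemma pruned_good n m x a b p q : pruned m x a b ->
  (p < 7 ^ n)%N -> (q < 7 ^ n)%N -> good (gap n m p q) (window n x a b p q).
Proof.
rewrite /pruned; set lo := vsub _ _; set hi := vsub _ _.
move=> /andP[/F_le_atP lo_ok /F_ge_atP hi_ok] lt_p lt_q.
have lo_F : F_le 12 (m + 1) (64 * gauge lo hi) by exists (scale_of (m + 1)); apply/F_le_atP.
have hi_F : F_ge 420 (m - 1) (512 * gauge hi lo) by exists (scale_of (m - 1)); apply/F_ge_atP.
have m1_gt0 : 0 < m - 1 by have := @pow_gt0 7 (scale_of (m - 1)) isT; lia.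
set D := window _ _ _ _ _ _.
have [gap_gt0 le_gap ge_gap] : [/\ 0 < gap n m p q,
    gap n m p q <= 7 ^ Z.of_nat n * (m + 1) & 7 ^ Z.of_nat n * (m - 1) <= gap n m p q].
  have := @pow_gt0 7 n isT; rewrite /gap.
  have : Z.of_nat p < 7 ^ Z.of_nat n by lia.
  have : Z.of_nat q < 7 ^ Z.of_nat n by lia.
  by split; nia.
have [lo_D D_hi] : vle (vscale (4 ^ Z.of_nat n) lo) (vscale 4 D) /\
    vle (vscale 4 D) (vscale (4 ^ Z.of_nat n) hi).
  have := pos_hull a lt_p; have := pos_hull b lt_q; rewrite /D /lo /hi /window.
  by rewrite /vle /=; lia.
have := gauge_le lo_D D_hi; have := gauge_le D_hi lo_D.
have q_ge0 : 0 <= 4 ^ Z.of_nat n by have := @pow_gt0 4 n isT; lia.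
rewrite !gauge_scale // => ge_D le_D; split.
  have [||k /F_le_atP [Hk Dk]] := @F_le_mono 12 (gap n m p q) _ _ _ _ (F_le_scale n lo_F).
  - lia.
  - lia.
  exists k; apply/F_le_atP; split=> //.
  have u_ge0 : 0 <= 7 ^ Z.of_nat k by have := @pow_gt0 7 k isT; lia.
  by have := Z.mul_le_mono_nonneg_r _ _ _ u_ge0 le_D; lia.
have [||k /F_ge_atP [Hk Dk]] := @F_ge_mono 420 _ (gap n m p q) _ _ _ (F_ge_scale n hi_F).
- lia.
- have := @pow_gt0 7 n isT; nia.
exists k; apply/F_ge_atP; split=> //.
have u_ge0 : 0 <= 7 ^ Z.of_nat k by have := @pow_gt0 7 k isT; lia.
by have := Z.mul_le_mono_nonneg_r _ _ _ u_ge0 ge_D; lia.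
Qed.

Lemma window0 x a b : window 0 x a b 0 0 = x.
Proof.
rewrite /window /pos !take0 Z.pow_0_r; case: x => u v w.
by congr Vect; rewrite /=; ring.
Qed.

Lemma tree_good f n m x a b p q : tree f m x a b ->
  (p < 7 ^ n)%N -> (q < 7 ^ n)%N -> good (gap n m p q) (window n x a b p q).
Proof.
elim: f n m x a b p q => [|f IHf] n m x a b p q; rewrite [tree _ _ _ _ _]/=.
  by case: ifP => [ok _|_]; [exact: pruned_good|rewrite andbF].
case: ifP => [ok _|_ /andP[/andP[lo_x x_hi] sub]]; first exact: pruned_good.
case: n => [|n].
  rewrite expn0 !ltnS !leqn0 => /eqP-> /eqP->; rewrite window0 /gap.
  rewrite Z.pow_0_r Z.mul_1_r Z.add_0_r Z.sub_0_r.
  by split; exists (scale_of m).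
move=> lt_p lt_q; apply: by_digits => // i j p' q' lt_i lt_j lt_p' lt_q' _ _.
exact: IHf (subtreesP sub lt_i lt_j) lt_p' lt_q'.
Qed.

Lemma root_good n m x a b p q : 2 <= m -> root m x a b ->
  (p < 7 ^ n)%N -> (q < 7 ^ n)%N -> good (gap n m p q) (window n x a b p q).
Proof.
rewrite /root => m_ge2; case: Z.leb_spec0 => [|_]; [lia|exact: tree_good].
Qed.

Lemma child_first s : child s 0 = s.
Proof. by case: s => a o []. Qed.

Lemma child_last s : child s 6 = s.
Proof. by case: s => a o []. Qed.

Lemma offset0 s : offset s 0 = vzero.
Proof. by rewrite /offset take0. Qed.

Lemma offsetS s i : (i < 7)%N ->
  offset s i.+1 = vadd (offset s i) (vstep (letter (child s i))).
Proof.
move=> lt_i; rewrite /offset (take_nth state0) ?size_children //.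
by rewrite map_rcons -cats1 disp_cat /= [vadd (vstep _) _]vaddC vadd0.
Qed.

(** Only the last sub-block of the first block and the first one of the second are consecutive
    again. They repeat the states and displacement of the original pair, hence the induction; all
    other pairs have [2 <= m]. *)
Lemma adjacent_good n s i p q : (i < 6)%N -> (p < 7 ^ n)%N -> (q < 7 ^ n)%N ->
  good (gap n 1 p q)
    (window n (vstep (letter (child s i))) (child s i) (child s i.+1) p q).
Proof.
move=> lt_i; have /andP[_ /(all_nthP 0%N)/(_ i)] := check_true s.
rewrite size_iota nth_iota // add0n => /(_ lt_i).
set a := child s i; set b := child s i.+1 => sub.
elim: n p q => [|n IHn] p q.
  rewrite expn0 !ltnS !leqn0 => /eqP-> /eqP->; rewrite window0 /gap.
  split; exists 0%N; by case: (letter a).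
move=> lt_p lt_q; apply: by_digits => // j k p' q' lt_j lt_k lt_p' lt_q' _ _.
have [/andP[/eqP-> /eqP->]|not_ends] := boolP ((j == 6%N) && (k == 0%N)).
  rewrite child_last child_first.
  have -> : vsub (vadd (vscale 4 (vstep (letter a))) (offset b 0)) (offset a 6)
      = vstep (letter a) by rewrite offset0; case: a {sub IHn} => [[] [] []].
  exact: IHn.
apply: root_good (subtreesP sub lt_j lt_k) lt_p' lt_q'.
by move: not_ends; lia.
Qed.

Lemma block_good n s p q : (p < q)%N -> (q < 7 ^ n)%N ->
  good (gap n 0 p q) (window n vzero s s p q).
Proof.
elim: n s p q => [|n IHn] s p q lt_pq; first by rewrite expn0; lia.
move=> lt_q; apply: by_digits => //; first exact: ltn_trans lt_q.
move=> i j p' q' lt_i lt_j lt_p' lt_q' Ep Eq.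
have lt_ij : (i <= j)%N.
  rewrite leqNgt; apply/negP => lt_ji; move: lt_pq; rewrite Ep Eq ltnNge.
  move=> /negP[]; apply: leq_trans (leq_trans (leq_mul lt_ji (leqnn _)) (leq_addr _ _)).
  by rewrite mulSn addnC leq_add2r ltnW.
have [Eij|ne_ij] := eqVneq i j.
  rewrite -Eij.
  have -> : vsub (vadd (vscale 4 vzero) (offset s i)) (offset s i) = vzero.
    by congr Vect; rewrite /=; ring.
  have -> : 7 * 0 + Z.of_nat i - Z.of_nat i = 0 by lia.
  by apply: IHn => //; move: lt_pq; rewrite Ep Eq Eij ltn_add2l.
have [Eij|ne_iSj] := eqVneq j i.+1.
  rewrite Eij offsetS // vscale0 vadd0.
  have -> : vsub (vadd (offset s i) (vstep (letter (child s i)))) (offset s i)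
      = vstep (letter (child s i)) by congr Vect; rewrite /=; ring.
  have -> : 7 * 0 + Z.of_nat i.+1 - Z.of_nat i = 1 by lia.
  by apply: adjacent_good => //; lia.
have /andP[sub _] := check_true s.
apply: root_good (subtreesP sub lt_i lt_j) lt_p' lt_q'.
by move: ne_ij ne_iSj; lia.
Qed.

(** * Collinear points *)

Definition walk_disp (p : nat) := disp (map GR_step (iota 1 p)).

Lemma walk_dispE n p : (p <= 7 ^ n)%N -> walk_disp p = pos n state0 p.
Proof.
move=> le_p; rewrite /pos -word_block -GR_stepP -map_take take_iota.
by rewrite (minn_idPl le_p).
Qed.

Lemma walk_good p q : (p < q)%N ->
  good (Z.of_nat q - Z.of_nat p) (vsub (walk_disp q) (walk_disp p)).
Proof.
move=> lt_pq; have lt_q : (q < 7 ^ q)%N by apply: ltn_expl.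
rewrite (walk_dispE (ltnW lt_q)) (walk_dispE (ltnW (ltn_trans lt_pq lt_q))).
have := block_good state0 lt_pq lt_q; rewrite /window vscale0 vadd0.
by congr good; rewrite /gap; lia.
Qed.

Lemma GR_walkS p : (GR_walk p.+1 = GR_walk p + vec (GR_step p.+1))%R.
Proof. by rewrite /GR_walk big_nat_recr. Qed.

Lemma GR_walk_disp p :
  let c j := 3 * Z_of_int (GR_walk p 0%R j) - Z.of_nat p in
  walk_disp p = Vect (c 0%R) (c 1%R) (c 2%R).
Proof.
elim: p => [|p /= IHp]; first by rewrite /GR_walk big_geq // !mxE.
have -> : walk_disp p.+1 = vadd (walk_disp p) (vstep (GR_step p.+1)).
  rewrite /walk_disp -[X in iota 1 X]addn1 iotaD map_cat disp_cat add1n /=.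
  by rewrite [vadd (vstep _) _]vaddC vadd0.
rewrite IHp GR_walkS; case: (GR_step p.+1); rewrite !mxE /=;
  congr Vect; rewrite /= /step /=; lia.
Qed.

(** This recovers the index linearly from the point, so along a line the index is affine in the
    parameter. *)
Lemma GR_walk_sum p : (\sum_j GR_walk p 0 j = p%:Z)%R.
Proof.
elim: p => [|p IHp]; first by rewrite /GR_walk big_geq // big1 // => j _; rewrite mxE.
rewrite GR_walkS; under eq_bigr do rewrite mxE.
rewrite big_split /= IHp intS GRing.addrC; congr (_ + _)%R.
by rewrite !big_ord_recl big_ord0; case: (GR_step _); rewrite !mxE.
Qed.

Lemma sparse_gaps (h x : nat) (t : seq nat) :
  path (fun p q => p + h <= q)%N x t -> (x + size t * h <= last x t)%N.
Proof.
elim: t x => [|y t IHt] x /=; first by rewrite mul0n addn0.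
move=> /andP[le_y /IHt]; apply: leq_trans.
by rewrite mulSn addnA leq_add2r.
Qed.

(** After sorting, the [(size t).-1] successive gaps are all at least the least gap [h], and they
    add up to the span from first to last. *)
Lemma small_gap (t : seq nat) : uniq t -> (1 < size t)%N ->
  exists p q p' q', [/\ [&& p \in t, q \in t, p' \in t & q' \in t],
    (p < q)%N & ((size t).-1 * (q - p) <= q' - p')%N].
Proof.
wlog lt_t : t / sorted ltn t => [wlog_t uniq_t gt1_t|].
  have [||| p [q [p' [q' [in_t lt_pq le]]]]] := wlog_t (sort leq t).
  - by rewrite ltn_sorted_uniq_leq sort_uniq uniq_t sort_sorted //; apply: leq_total.
  - by rewrite sort_uniq.
  - by rewrite size_sort.
  by exists p, q, p', q'; rewrite size_sort in le; move: in_t; rewrite !mem_sort.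
case: t lt_t => [|x [|y t]] // lt_t _ _; set s := x :: y :: t.
pose is_gap h := has (fun p => has (fun q => (p < q) && (q - p == h))%N s) s.
have gap_ex : exists h, is_gap h.
  exists (y - x)%N; apply/hasP; exists x; first exact: mem_head.
  by apply/hasP; exists y; [rewrite !inE eqxx orbT|rewrite eqxx andbT; case/andP: lt_t].
case: (ex_minnP gap_ex) => h /hasP[p s_p /hasP[q s_q /andP[lt_pq /eqP Eh]]] h_min.
exists p, q, x, (last x (y :: t)); split=> //.
  by rewrite s_p s_q mem_head mem_last.
rewrite Eh leq_subRL; last first.
  have /allP lt_x : all (ltn x) (y :: t) := order_path_min ltn_trans lt_t.
  by apply/ltnW/lt_x; rewrite /= mem_last.
apply: sparse_gaps; apply: (@sub_in_path _ (mem s) ltn _ _ x (y :: t) _ lt_t);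
  last exact/allP.
move=> i j s_i s_j /= lt_ij; have : is_gap (j - i)%N.
  by apply/hasP; exists i => //; apply/hasP; exists j; rewrite // lt_ij eqxx.
by move/h_min; rewrite leq_subRL // ltnW.
Qed.

Lemma preimages (T U : eqType) (f : T -> U) (Q : T -> Prop) (s : seq U) :
  (forall y, y \in s -> exists2 x, Q x & f x = y) ->
  exists2 t, map f t = s & forall x, x \in t -> Q x.
Proof.
elim: s => [|y s IHs] H; first by exists [::].
have [x Qx fx] := H y (mem_head _ _).
have [|t ft Qt] := IHs; first by move=> z s_z; apply: H; rewrite inE s_z orbT.
exists (x :: t) => [|z]; first by rewrite /= fx ft.
by rewrite inE => /orP[/eqP->|/Qt].
Qed.

Local Close Scope Z_scope.
Local Open Scope ring_scope.
Local Open Scope classical_set_scope.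
Import GRing.Theory Num.Theory.

Lemma collinear_proportional (R : realType) (L : set 'rV[R]_3) (p q p' q' : nat) :
  is_line L ->
  (forall r, r \in [:: p; q; p'; q'] -> L (map_mx intr (GR_walk r))) ->
  forall j, (q'%:Z - p'%:Z) * (GR_walk q 0 j - GR_walk p 0 j) =
            (q%:Z - p%:Z) * (GR_walk q' 0 j - GR_walk p' 0 j).
Proof.
move=> [a [u [_ ->]]] on_L.
have param r : r \in [:: p; q; p'; q'] -> exists t,
    (forall j, (GR_walk r 0 j)%:~R = a 0 j + t * u 0 j) /\
    r%:R = \sum_j a 0 j + t * \sum_j u 0 j.
  move=> /on_L [t _ /matrixP Et]; exists t.
  have {}Et j : (GR_walk r 0 j)%:~R = a 0 j + t * u 0 j.
    by have := Et 0 j; rewrite !mxE.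
  split=> //; have /(congr1 (fun z : int => z%:~R : R)) := GR_walk_sum r.
  rewrite rmorph_sum /= -pmulrn => <-; rewrite mulr_sumr -big_split /=.
  exact: eq_bigr.
move=> j; apply: (@intr_inj R); rewrite !rmorphM !rmorphB /= -!pmulrn.
have [|tp [Ep ->]] := param p; first by rewrite !inE eqxx.
have [|tq [Eq ->]] := param q; first by rewrite !inE eqxx orbT.
have [|tp' [Ep' ->]] := param p'; first by rewrite !inE eqxx !orbT.
have [|tq' [Eq' ->]] := param q'; first by rewrite !inE eqxx !orbT.
by rewrite Ep Eq Ep' Eq'; ring.
Qed.

Theorem theorem1 (R : realType) (L : set 'rV[R]_3) (hL : is_line L) :
  ~ (exists s : seq 'rV[R]_3,
       [/\ uniq s, (189 <= size s)%N & [set` s] `<=` L `&` @GR_points R]).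
Proof.
move=> [s [uniq_s size_s sub_s]].
pose pt p : 'rV[R]_3 := map_mx intr (GR_walk p).
have [|t Et L_t] := @preimages nat _ pt (fun p => L (pt p)) s.
  by move=> y /sub_s [Ly [p _ Ey]]; exists p; rewrite // /pt Ey.
have uniq_t : uniq t by apply: (@map_uniq _ _ pt); rewrite Et.
have size_t : (189 <= size t)%N by move: size_s; rewrite -Et size_map.
have [|p [q [p' [q' [/and4P[tp tq tp' tq'] lt_pq le]]]]] := small_gap uniq_t.
  exact: leq_trans size_t.
have {}le : (188 * (q - p) <= q' - p')%N.
  by apply: leq_trans le; rewrite leq_mul // -ltnS (ltn_predK size_t).
have lt_pq' : (p' < q')%N by lia.
have L_pq r : r \in [:: p; q; p'; q'] -> L (pt r).
  by rewrite !inE => /or4P[] /eqP->; apply: L_t.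
have prop := collinear_proportional hL L_pq.
apply: (good_far _ _ _ (walk_good lt_pq) (walk_good lt_pq')); [lia..|].
(* The index terms of [walk_disp] agree on both sides, so [prop] on the three coordinates is
   enough. *)
rewrite !GR_walk_disp; move: (prop 0) (prop 1) (prop 2).
by move=> *; congr Vect; rewrite /=; lia.
Qed.
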